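(* Let $X$ be a real or complex Hilbert space, regarded as a type I Cartan factor, i.e. as a real (resp., complex) Jordan Banach triple with product $\{x,y,z\}=\frac12\big((x|y)z+(z|y)x\big)$, where $(\cdot|\cdot)$ is the inner product of $X$. Then $X$ is ternary weakly amenable if and only if $X$ is finite dimensional.
   Context: Inner products are linear in the first variable and, in the complex case, conjugate linear in the second. Let $E$ be a real or complex Jordan Banach triple. The dual $E^*$ is a Jordan triple $E$-module with the products $\{a,b,\varphi\}(x)=\{\varphi,b,a\}(x):=\varphi(\{b,a,x\})$ and $\{a,\varphi,b\}(x):=\overline{\varphi(\{a,x,b\})}$ for $a,b,x\in E$, $\varphi\in E^*$ (in the real case the conjugation is trivial). A ternary derivation $\delta:E\to E^*$ is a conjugate linear (linear, in the real case) map with $\delta\{a,b,c\}=\{\delta(a),b,c\}+\{a,\delta(b),c\}+\{a,b,\delta(c)\}$ for all $a,b,c\in E$. For $b\in E$, $\varphi\in E^*$, the map $\delta(b,\varphi)(a):=\{b,\varphi,a\}-\{\varphi,b,a\}$ is a ternary derivation $E\to E^*$; finite sums of such maps are called inner ternary derivations. $E$ is ternary weakly amenable if every continuous ternary derivation $E\to E^*$ is inner. *)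

(* Defs.v *)
From HB Require Import structures.
From mathcomp Require Import all_boot all_order all_algebra.
From mathcomp Require Import complex.
From mathcomp Require Import all_classical all_reals all_analysis.
From mathcomp Require Import ring.

Set Implicit Arguments.
Unset Strict Implicit.
Unset Printing Implicit Defensive.

Import Order.TTheory GRing.Theory Num.Theory.
Import numFieldNormedType.Exports.

Local Open Scope classical_set_scope.
Local Open Scope ring_scope.

Variant scalars := RealScalars | ComplexScalars.

Definition scalar_field (R : realType) (k : scalars) : numFieldType :=
  match k with RealScalars => R | ComplexScalars => R[i] end.

Definition sconj (R : realType) (k : scalars) :
    scalar_field R k -> scalar_field R k :=
  match k with RealScalars => fun z => z | ComplexScalars => @conjc R end.
Arguments sconj {R k}.

Section Scalars.
Variables (R : realType) (k : scalars).
Local Notation K := (scalar_field R k).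

Lemma sconj_is_zmod_morphism : zmod_morphism (@sconj R k).
Proof. by case: k => //= x y; rewrite rmorphB. Qed.

Lemma sconj_is_monoid_morphism : monoid_morphism (@sconj R k).
Proof.
by case: k => /=; split => // [|x y]; [exact: rmorph1 | exact: rmorphM].
Qed.

HB.instance Definition _ :=
  GRing.isZmodMorphism.Build K K sconj sconj_is_zmod_morphism.
HB.instance Definition _ :=
  GRing.isMonoidMorphism.Build K K sconj sconj_is_monoid_morphism.

Lemma sconjK : involutive (@sconj R k).
Proof. by case: k => //=; exact: conjcK. Qed.

Lemma mul_sconj (z : K) : z * sconj z = `|z| ^+ 2.
Proof.
case: k z => /= z; first by rewrite -expr2 real_normK // num_real.
by rewrite -sqr_normc.
Qed.

Lemma norm_sconj (z : K) : `|sconj z| = `|z|.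
Proof.
by apply/eqP; rewrite -(@eqrXn2 _ 2) // -!mul_sconj sconjK mulrC.
Qed.

Lemma supremums_normr (A : set K) : A !=set0 -> (forall z, A z -> 0 <= z) ->
  ubound A !=set0 -> supremums A !=set0.
Proof.
case: k A => /= A [a Aa] A0 [M ubM].
  have hA : has_sup A by split; [exists a | exists M].
  exists (sup A); split; first exact: sup_upper_bound.
  by move=> y uy; apply: ge_sup => //; exists a.
have ReK z : A z -> z = (complex.Re z)%:C%C.
  move=> /A0; rewrite lecE => /andP[/eqP/= z0 _].
  by case: z z0 => u v /= ->.
pose B : set R := [set complex.Re z | z in A].
have hB : has_sup B.
  split; first by exists (complex.Re a), a.
  exists (complex.Re M) => _ [z Az <-].
  by have := ubM _ Az; rewrite lecE => /andP[].
exists (sup B)%:C%C; split.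
  move=> z Az; rewrite (ReK _ Az) lecR.
  by apply: sup_upper_bound => //; exists z.
move=> y uy; rewrite lecE /=; apply/andP; split.
  by have := uy _ Aa; rewrite {1}(ReK _ Aa) lecE => /andP[].
apply: ge_sup; first by exists (complex.Re a), a.
by move=> _ [z Az <-]; have := uy _ Az; rewrite lecE => /andP[].
Qed.

End Scalars.

Section Dual.
Variables (R : realType) (k : scalars).
Local Notation K := (scalar_field R k).
Variable E : normedModType K.

Definition continuous_functional : {pred E -> K^o} :=
  [pred f : E -> K^o | `[< linear f /\ continuous f >]].

Lemma continuous_functionalP (f : E -> K^o) :
  reflect (linear f /\ continuous f) (f \in continuous_functional).
Proof. exact: asboolP. Qed.

Lemma continuous_functional_submod_closed :
  submod_closed continuous_functional.
Proof.
split=> [|c f g /continuous_functionalP[lf cf] /continuous_functionalP[lg cg]];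
  apply/continuous_functionalP; split.
- by move=> a x y /=; rewrite scaler0 addr0.
- exact: cst_continuous.
- move=> a x y; rewrite /= !fctE lf lg /= !scalerDr !scalerA [c * a]mulrC.
  by rewrite -!addrA; congr (_ + _); rewrite addrCA.
- by move=> x; apply: cvgD; [apply: cvgZl_tmp; exact: cf | exact: cg].
Qed.

HB.instance Definition _ := GRing.isSubmodClosed.Build K (E -> K^o)
  continuous_functional continuous_functional_submod_closed.

Record dual := Dual {
  dual_fun :> E -> K^o;
  dual_funP : dual_fun \in continuous_functional }.

HB.instance Definition _ := [isSub for dual_fun].
HB.instance Definition _ := [Choice of dual by <:].
HB.instance Definition _ := [SubChoice_isSubLmodule of dual by <:].

Implicit Types f g : dual.

Lemma dual_linear f : linear f.
Proof. by have /continuous_functionalP[] := dual_funP f. Qed.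

Lemma dual_continuous f : continuous f.
Proof. by have /continuous_functionalP[] := dual_funP f. Qed.

HB.instance Definition _ f :=
  GRing.isLinear.Build K E K^o *:%R (dual_fun f) (dual_linear f).

Lemma dualDE f g x : (f + g) x = f x + g x. Proof. by []. Qed.

Lemma dualZE c f x : (c *: f) x = c * f x. Proof. by []. Qed.

Lemma dual_ext f g : f =1 g -> f = g.
Proof. by move=> fg; apply/val_inj/funext. Qed.

(* The operator norm. Norms over K take values in K, so in the complex case
   this is a supremum for the partial order of R[i]; it exists by
   [supremums_normr], since the values are nonnegative, hence real. *)
Definition dual_norm f : K :=
  supremum 0 [set `|f x| | x in [set x : E | `|x| <= 1]].

Let unit_values f : set K := [set `|f x| | x in [set x : E | `|x| <= 1]].

Let supremums_unit_values f : supremums (unit_values f) !=set0.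
Proof.
apply: supremums_normr.
- by exists `|f 0|, 0; rewrite //= normr0.
- by move=> _ [x _ <-].
have /linear_boundedP/pinfty_ex_gt0[M M0 fM] :=
  continuous_linear_bounded 0 (@dual_continuous f 0).
exists M => _ [x /= x1 <-]; apply: (le_trans (fM x)).
by rewrite -[leRHS]mulr1 ler_wpM2l // ltW.
Qed.

Let dual_normP f : supremums (unit_values f) (dual_norm f).
Proof.
rewrite /dual_norm /supremum; case: eqP => [A0|_].
  have : unit_values f `|f 0| by exists 0; rewrite //= normr0.
  by rewrite /unit_values A0.
by case: xgetP => // nA; have [y /nA] := supremums_unit_values f.
Qed.

Lemma dual_norm_le f (M : K) :
  (forall x, `|x| <= 1 -> `|f x| <= M) -> dual_norm f <= M.
Proof.
move=> fM; have [_ +] := dual_normP f; apply.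
by move=> _ [x x1 <-]; exact: fM.
Qed.

Lemma le_dual_norm1 f x : `|x| <= 1 -> `|f x| <= dual_norm f.
Proof. by move=> x1; have [+ _] := dual_normP f; apply; exists x. Qed.

Lemma dual_norm_ge0 f : 0 <= dual_norm f.
Proof. by apply: le_trans (le_dual_norm1 f (x := 0) _); rewrite ?normr0. Qed.

Lemma le_dual_norm f x : `|f x| <= dual_norm f * `|x|.
Proof.
have [->|x0] := eqVneq x 0; first by rewrite linear0 !normr0 mulr0.
have nx0 : 0 < `|x| by rewrite normr_gt0.
have : `|f (`|x|^-1 *: x)| <= dual_norm f.
  by apply: le_dual_norm1; rewrite normrZ normfV normr_id mulVf // gt_eqF.
by rewrite linearZ /= normrZ normfV normr_id mulrC ler_pdivrMr.
Qed.

Lemma dual_normD f g : dual_norm (f + g) <= dual_norm f + dual_norm g.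
Proof.
apply: dual_norm_le => x x1; rewrite dualDE.
by apply: (le_trans (ler_normD _ _)); apply: lerD; exact: le_dual_norm1.
Qed.

Let dual_normZ_le c f : dual_norm (c *: f) <= `|c| * dual_norm f.
Proof.
apply: dual_norm_le => x x1; rewrite dualZE normrM.
by apply: ler_wpM2l => //; exact: le_dual_norm1.
Qed.

Lemma dual_normZ c f : dual_norm (c *: f) = `|c| * dual_norm f.
Proof.
apply/eqP; rewrite eq_le dual_normZ_le /=.
have [->|c0] := eqVneq c 0; first by rewrite normr0 mul0r dual_norm_ge0.
rewrite -{1}[f](scalerK c0) mulrC -ler_pdivlMr ?normr_gt0 //.
by rewrite mulrC -normfV dual_normZ_le.
Qed.

Lemma dual_norm_eq0 f : dual_norm f = 0 -> f = 0.
Proof.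
move=> f0; apply: dual_ext => x; apply/eqP; rewrite -normr_le0.
by apply: le_trans (le_dual_norm f x) _; rewrite f0 mul0r.
Qed.

HB.instance Definition _ :=
  Lmodule_isNormed.Build K dual dual_normD dual_normZ dual_norm_eq0.

End Dual.

Arguments continuous_functional {R k} E.

Section JordanBanachTriple.
Variables (R : realType) (k : scalars).
Local Notation K := (scalar_field R k).

(* [sconj \; *:%R] is scaling by the conjugate scalar, so [linear_for] it is
   conjugate linearity (linearity over the reals). *)
Record jordan_banach_triple (E : completeNormedModType K) := JordanBanachTriple {
  tprod :> E -> E -> E -> E;
  tprodC : forall a b c, tprod a b c = tprod c b a;
  tprod_linear : forall b c, linear (fun a => tprod a b c);
  tprod_conj_linear : forall a c,
    linear_for (sconj \; *:%R) (fun b => tprod a b c);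
  tprod_jordan : forall a b x y z,
    tprod a b (tprod x y z) = tprod (tprod a b x) y z
      - tprod x (tprod b a y) z + tprod x y (tprod a b z);
  tprod_continuous :
    continuous (fun p : (E * E) * E => tprod p.1.1 p.1.2 p.2) }.

Variables (E : completeNormedModType K) (T : jordan_banach_triple E).
Local Notation "E ^*" := (dual E) : type_scope.

Lemma continuous_tprodr a b : continuous (T a b).
Proof.
move=> x; apply: (@continuous2_cvg _ _ _ _ _ _ (cst (a, b)) id
  (fun p z => T p.1 p.2 z) (a, b) x);
    first exact: (@tprod_continuous _ T ((a, b), x)).
- exact: cvg_cst.
- exact: cvg_id.
Qed.

Lemma continuous_tprodm a c : continuous (fun b => T a b c).
Proof.
move=> x; apply: (@continuous2_cvg _ _ _ _ _ _ (fun z => (a, z)) (cst c)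
  (fun p z => T p.1 p.2 z) (a, x) c);
    first exact: (@tprod_continuous _ T ((a, x), c)).
- apply: (@cvg_pair _ _ _ _ (nbhs a) (nbhs x)); first exact: cvg_cst.
  exact: cvg_id.
- exact: cvg_cst.
Qed.

Lemma continuous_sconj : continuous (sconj : K^o -> K^o).
Proof.
move=> z; apply/(@cvgrPdist_lt _ _ _ (nbhs z)) => e e0; near=> w.
by rewrite -rmorphB norm_sconj; near: w; apply: cvgr_dist_lt.
Unshelve. all: by end_near. Qed.

Fact outer_subproof (phi : E^*) (b a : E) :
  (fun x => phi (T b a x)) \in continuous_functional E.
Proof.
apply/continuous_functionalP; split=> [c x y|x].
  rewrite tprodC tprod_linear -![T _ _ b]tprodC.
  exact: dual_linear.
apply: (@continuous_comp _ _ _ (T b a) phi); first exact: continuous_tprodr.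
exact: dual_continuous.
Qed.

Fact middle_subproof (a : E) (phi : E^*) (b : E) :
  (fun x => sconj (phi (T a x b))) \in continuous_functional E.
Proof.
apply/continuous_functionalP; split=> [c x y|x].
  rewrite tprod_conj_linear /= dual_linear rmorphD /=; congr (_ + _).
  by rewrite [LHS]rmorphM /= sconjK.
apply: (@continuous_comp _ _ _ (fun x => phi (T a x b)) sconj); last first.
  exact: continuous_sconj.
apply: (@continuous_comp _ _ _ (fun x => T a x b) phi); last first.
  exact: dual_continuous.
exact: continuous_tprodm.
Qed.

(* The module products on the dual: [outer phi b a] is {phi, b, a}, equal by
   definition to {a, b, phi}, and [middle a phi b] is {a, phi, b}. *)
Definition outer (phi : E^*) (b a : E) : E^* := Dual (outer_subproof phi b a).

Definition middle (a : E) (phi : E^*) (b : E) : E^* :=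
  Dual (middle_subproof a phi b).

Definition ternary_derivation (delta : E -> E^*) :=
  linear_for (sconj \; *:%R) delta /\
  forall a b c, delta (T a b c) =
    outer (delta a) b c + middle a (delta b) c + outer (delta c) b a.

Definition elementary_derivation (b : E) (phi : E^*) (a : E) : E^* :=
  middle b phi a - outer phi b a.

Definition inner_ternary_derivation (delta : E -> E^*) :=
  exists (n : nat) (b : 'I_n -> E) (phi : 'I_n -> E^*),
    forall a, delta a = \sum_(i < n) elementary_derivation (b i) (phi i) a.

Definition ternary_weakly_amenable :=
  forall delta : E -> E^*, ternary_derivation delta -> continuous delta ->
    inner_ternary_derivation delta.

End JordanBanachTriple.

Definition finite_dimensional (F : fieldType) (V : lmodType F) :=
  exists (n : nat) (e : 'I_n -> V),
    forall x, exists c : 'I_n -> F, x = \sum_(i < n) c i *: e i.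

Section HilbertTriple.
Variables (R : realType) (k : scalars).
Local Notation K := (scalar_field R k).
Variables (X : completeNormedModType K) (ip : {dot X for @sconj R k}).
Hypothesis norm_ip : forall x : X, `|x| ^+ 2 = ip x x.

Definition hilbert_prod (x y z : X) : X :=
  2^-1 *: (ip x y *: z + ip z y *: x).

Let ipl (c : K) x y z : ip (c *: x + y) z = c * ip x z + ip y z.
Proof. by rewrite linearDl linearZl_LR. Qed.

Let ipr (c : K) x y z : ip z (c *: x + y) = sconj c * ip z x + ip z y.
Proof. by rewrite linearDr linearZr. Qed.

Let ipC x y : ip x y = sconj (ip y x).
Proof. by rewrite hermC expr0 mul1r. Qed.

Let cs_identity (F : fieldType) (p q n m : F) : n != 0 ->
  - (p / n) * (- (q / n) * n + q) + (- (q / n) * p + m) = m - (p * q) / n.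
Proof. by move=> n0; field. Qed.

Lemma ip_norm_le x y : `|ip x y| <= `|x| * `|y|.
Proof.
have [->|y0] := eqVneq y 0; first by rewrite linear0r !normr0 mulr0.
have ny : 0 < `|y| ^+ 2 by rewrite exprn_gt0 // normr_gt0.
have ipyy : ip y y = `|y| ^+ 2 by rewrite norm_ip.
have ny0 : `|y| ^+ 2 != 0 by rewrite gt_eqF.
have nyc : sconj (`|y| ^+ 2) = `|y| ^+ 2 by rewrite -ipyy -ipC.
pose c := - (ip x y / `|y| ^+ 2).
have : 0 <= ip (c *: y + x) (c *: y + x) by rewrite -norm_ip exprn_ge0.
rewrite ipl !ipr (ipC y x) ipyy -norm_ip.
have -> : sconj c = - (sconj (ip x y) / `|y| ^+ 2).
  by rewrite /c rmorphN rmorphM fmorphV /= nyc.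
have -> : - (ip x y / `|y| ^+ 2) *
      (- (sconj (ip x y) / `|y| ^+ 2) * `|y| ^+ 2 + sconj (ip x y)) +
    (- (sconj (ip x y) / `|y| ^+ 2) * ip x y + `|x| ^+ 2) =
    `|x| ^+ 2 - (ip x y * sconj (ip x y)) / `|y| ^+ 2 by exact: cs_identity.
rewrite mul_sconj subr_ge0 ler_pdivrMr // -exprMn.
by rewrite ler_pXn2r // nnegrE mulr_ge0.
Qed.

Lemma ip_continuous : continuous (fun p : X * X => ip p.1 p.2 : K^o).
Proof.
move=> [x0 y0]; rewrite /continuous_at /=.
have dE (p : X * X) : ip x0 y0 - ip p.1 p.2 =
    ip (x0 - p.1) y0 + (ip p.1 (y0 - p.2)).
  by rewrite linearBl /= linearBr /= addrA subrK.
have fst0 : (fun p : X * X => p.1) @ (x0, y0) --> x0 by exact: cvg_fst.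
have snd0 : (fun p : X * X => p.2) @ (x0, y0) --> y0 by exact: cvg_snd.
have d0 : `|x0 - p.1| * `|y0| + `|p.1| * `|y0 - p.2|
    @[p --> (x0, y0)] --> (0 : K).
  have -> : (0 : K) = `|x0 - x0| * `|y0| + `|x0| * `|y0 - y0|.
    by rewrite !subrr !normr0 mul0r mulr0 addr0.
  apply: cvgD; apply: cvgM.
  - apply: (@cvg_norm _ _ _ _ _ (fun p : X * X => x0 - p.1)).
    by apply: cvgB => //; exact: cvg_cst.
  - exact: cvg_cst.
  - exact: (@cvg_norm _ _ _ _ _ (fun p : X * X => p.1)).
  - apply: (@cvg_norm _ _ _ _ _ (fun p : X * X => y0 - p.2)).
    by apply: cvgB => //; exact: cvg_cst.
apply/(@cvgrPdist_lt _ _ _ (nbhs (x0, y0))) => e e0; near=> p.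
rewrite dE; apply: (le_lt_trans (ler_normD _ _)).
apply: (le_lt_trans (lerD (ip_norm_le _ _) (ip_norm_le _ _))).
suff : `|0 - (`|x0 - p.1| * `|y0| + `|p.1| * `|y0 - p.2|)| < e.
  by rewrite sub0r normrN ger0_norm // addr_ge0 ?mulr_ge0.
near: p; move/cvgrPdist_lt : d0 => /(_ e e0); exact.
Unshelve. all: by end_near. Qed.

Fact hilbert_prod_sym a b c : hilbert_prod a b c = hilbert_prod c b a.
Proof. by rewrite /hilbert_prod addrC. Qed.

Fact hilbert_prod_linear b c : linear (fun a => hilbert_prod a b c).
Proof.
move=> u x y; rewrite /hilbert_prod ipl [u *: (_ *: _)]scalerA [u * 2^-1]mulrC.
rewrite -scalerA -scalerDr; congr (_ *: _).
by rewrite scalerDl !scalerDr !scalerA [ip c b * u]mulrC addrACA.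
Qed.

Fact hilbert_prod_conj_linear a c :
  linear_for (sconj \; *:%R) (fun b => hilbert_prod a b c).
Proof.
move=> u x y; rewrite /hilbert_prod /= !ipr [sconj u *: (_ *: _)]scalerA.
rewrite [sconj u * 2^-1]mulrC -scalerA -scalerDr.
by congr (_ *: _); rewrite !scalerDl !scalerDr !scalerA addrACA.
Qed.

Let jordan_identity (F : fieldType) (V : lmodType F) (h : F)
    (ab xy zy xb zb ay : F) (a x z : V) :
  h *: (ab *: (h *: (xy *: z + zy *: x)) + h * (xy * zb + zy * xb) *: a) =
  h *: (h * (ab * xy + xb * ay) *: z + zy *: (h *: (ab *: x + xb *: a)))
  - h *: (h * (ab * xy + ay * xb) *: z + h * (ab * zy + ay * zb) *: x)
  + h *: (xy *: (h *: (ab *: z + zb *: a)) + h * (ab * zy + zb * ay) *: x).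
Proof.
have [comb combE] : exists f : F -> F -> F -> V,
  forall p q r, f p q r = p *: a + q *: x + r *: z by eexists.
have aE c : c *: a = comb c 0 0 by rewrite combE !scale0r !addr0.
have xE c : c *: x = comb 0 c 0 by rewrite combE !scale0r add0r addr0.
have zE c : c *: z = comb 0 0 c by rewrite combE !scale0r !add0r.
have combD p q r p' q' r' :
    comb p q r + comb p' q' r' = comb (p + p') (q + q') (r + r').
  by rewrite !combE !scalerDl addrACA; congr (_ + _); rewrite addrACA.
have combZ c p q r : c *: comb p q r = comb (c * p) (c * q) (c * r).
  by rewrite !combE !scalerDr !scalerA.
rewrite !zE !xE !aE !(combZ, combD) -!scaleN1r !(combZ, combD).
by congr comb; ring.
Qed.

Fact hilbert_prod_jordan a b x y z :
  hilbert_prod a b (hilbert_prod x y z) =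
    hilbert_prod (hilbert_prod a b x) y z
    - hilbert_prod x (hilbert_prod b a y) z
    + hilbert_prod x y (hilbert_prod a b z).
Proof.
have sconj2 : sconj (2^-1 : K) = 2^-1 by rewrite fmorphV rmorph_nat.
have ipL p q u v w :
    ip (2^-1 *: (p *: u + q *: v)) w = 2^-1 * (p * ip u w + q * ip v w).
  by rewrite linearZl_LR linearDl !linearZl_LR.
have ipR p q u v w : ip w (2^-1 *: (p *: u + q *: v)) =
    2^-1 * (sconj p * ip w u + sconj q * ip w v).
  by rewrite linearZr linearDr !linearZr /= sconj2.
rewrite /hilbert_prod !ipL !ipR -!ipC.
exact: jordan_identity.
Qed.

Fact hilbert_prod_continuous :
  continuous (fun p : (X * X) * X => hilbert_prod p.1.1 p.1.2 p.2).
Proof.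
move=> p.
have c11 : q.1.1 @[q --> p] --> p.1.1.
  by apply: (@cvg_comp _ _ _ (fun q : (X * X) * X => q.1) fst _ (nbhs p.1));
    exact: cvg_fst.
have c12 : q.1.2 @[q --> p] --> p.1.2.
  apply: (@cvg_comp _ _ _ (fun q : (X * X) * X => q.1) snd _ (nbhs p.1)).
    exact: cvg_fst.
  exact: cvg_snd.
have c2 : q.2 @[q --> p] --> p.2 by exact: cvg_snd.
have cip (f g : (X * X) * X -> X) : f q @[q --> p] --> f p ->
    g q @[q --> p] --> g p -> (ip (f q) (g q) : K^o) @[q --> p] --> ip (f p) (g p).
  move=> cf cg; apply: (@continuous2_cvg _ _ _ _ _ _ f g
    (fun x y => ip x y : K^o)) => //.
  exact: (@ip_continuous (f p, g p)).
apply: cvgZl_tmp; apply: cvgD; apply: cvgZ => //; exact: cip.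
Qed.

Definition hilbert_triple : jordan_banach_triple X :=
  JordanBanachTriple hilbert_prod_sym hilbert_prod_linear
    hilbert_prod_conj_linear hilbert_prod_jordan hilbert_prod_continuous.

End HilbertTriple.

(* Main.v *)
From HB Require Import structures.
Require Import Defs.
From mathcomp Require Import all_boot all_order all_algebra.
From mathcomp Require Import complex.
From mathcomp Require Import all_classical all_reals all_analysis.
From mathcomp Require Import ring.

(** A continuous conjugate linear map delta from X to its dual has the form
    delta(a)(x) = (x | D a) for a bounded linear D, and expanding the triple
    product shows that delta is a ternary derivation exactly when D is
    skew-adjoint, that is delta(a)(b) = - conj (delta(b)(a))
    ([derivation_skew], [skew_derivation]).  The inner derivation attached to
    b and phi = (. | v) corresponds to
      D a = 1/2 ((a | v) b - (a | b) v + ((b | v) - (v | b)) a),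
    so for an inner derivation D is a finite rank operator plus a scalar.

    In finite dimension every skew D is of this form, with one elementary
    derivation for each vector v of an orthonormal basis.  Taking
    phi_v = - delta(v) gives D + tr(D) instead of D: over the complex numbers
    the scalar terms of the elementary derivations add up to the trace.
    Replacing D by D - c I with c (1 + dim X) = tr(D) cancels this excess
    ([finite_dimensional_inner]).

    In infinite dimension, an orthonormal sequence f_0, g_0, f_1, g_1, ...
    gives the norm convergent series J x = sum_n 2^-n (x | f_n) g_n, whose
    skew part D = J - J^* defines a continuous derivation
    ([skew_part_derivation]).  If it were inner, the finitely many linear
    conditions phi_i(a) = 0 and (a | b_i) = 0 would have a nonzero solution a
    in the span of the f_j, on which D acts as a scalar
    ([inner_scalar_vector]); but D sends the span of the f_j injectively into
    the span of the g_j, which is orthogonal to it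
    ([amenable_finite_dimensional]). *)

Set Implicit Arguments.
Unset Strict Implicit.
Unset Printing Implicit Defensive.

Import Order.TTheory GRing.Theory Num.Theory.
Import numFieldNormedType.Exports.

Local Open Scope classical_set_scope.
Local Open Scope ring_scope.

(** * Bounded operators and geometric series *)

(** Stated for additive rather than linear maps, so that it also covers
    conjugate linear ones. *)
Lemma bounded_additive_continuous (K : numFieldType)
    (V W : normedModType K) (f : V -> W) (C : K) :
  (forall x y, f (x - y) = f x - f y) ->
  (forall x, `|f x| <= C * `|x|) -> continuous f.
Proof.
move=> fB fC x; apply/(@cvgrPdist_lt _ _ _ (nbhs x)) => e e0.
have C0 : 0 < `|C| + 1 by rewrite ltr_wpDl ?ltr01.
near=> y; rewrite -fB; apply: le_lt_trans (fC _) _.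
have [xy|xy] := eqVneq (x - y) 0; first by rewrite xy normr0 mulr0.
have nxy : 0 < `|x - y| by rewrite normr_gt0.
have Cpos : 0 <= C.
  by have := le_trans (normr_ge0 _) (fC (x - y)); rewrite pmulr_lge0.
apply: (@le_lt_trans _ _ ((`|C| + 1) * `|x - y|)).
  by rewrite ler_wpM2r // ger0_norm // lerDl ler01.
rewrite mulrC -ltr_pdivlMr //; near: y.
by apply: cvgr_dist_lt => //; rewrite divr_gt0.
Unshelve. all: by end_near. Qed.

Section GeometricSum.
Variables (R : realType) (k : scalars).
Local Notation K := (scalar_field R k).

(** Stated for the scalar field itself because the series below is measured by
    norms with values in it; a positive complex number is a positive real. *)
Lemma half_expr_lt (e : K) : 0 < e -> exists n, 2^-1 ^+ n < e.
Proof.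
have realH (r : R) : 0 < r -> exists n, 2^-1 ^+ n < r.
  move=> r0; exists (Num.truncn r^-1).+1.
  rewrite exprVn invf_plt ?posrE ?exprn_gt0 //.
  apply: lt_trans (truncnS_gt _) _.
  by rewrite -natrX ltr_nat ltn_expl.
case: k e => /= e; first exact: realH.
rewrite ltcE => /andP[/eqP/= e0 /realH[n ne]]; exists n.
have -> : (2^-1 : R[i]) ^+ n = ((2^-1) ^+ n)%:C%C.
  by rewrite rmorphXn fmorphV rmorph_nat.
by rewrite ltcE /= e0 eqxx.
Qed.

Variables (V : completeNormedModType K) (t : nat -> V -> V).
Hypothesis linear_t : forall n, linear (t n).
Hypothesis norm_t : forall n x, `|t n x| <= 2^-1 ^+ n * `|x|.

Let tail_le x N n : (N <= n)%N ->
  `|\sum_(N <= i < n) t i x| <= 2 * 2^-1 ^+ N * `|x|.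
Proof.
move=> Nn; apply: le_trans (ler_norm_sum _ _ _) _.
have half0 m : 0 <= (2^-1 : K) ^+ m by rewrite exprn_ge0 ?invr_ge0 ?ler0n.
apply: (@le_trans _ _ (\sum_(N <= i < n) 2^-1 ^+ i * `|x|)).
  by apply: ler_sum => i _.
rewrite -mulr_suml; apply: ler_wpM2r => //.
pose h i : K := - (2 * 2^-1 ^+ i).
have -> : \sum_(N <= i < n) (2^-1 : K) ^+ i = \sum_(N <= i < n) (h i.+1 - h i).
  by apply: eq_bigr => i _; rewrite /h exprS; field.
by rewrite telescope_sumr // /h opprK addrC gerBl mulr_ge0 ?ler0n.
Qed.

(** The series converges absolutely since V is complete.  The constant is
    3 rather than 2 to avoid a passage to the limit in the order of the complex
    numbers: partial sums are bounded by 2 |x|, and one of them is within |x| of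
    the limit. *)
Lemma geometric_sum_operator : exists J : V -> V,
  [/\ linear J, forall x, `|J x| <= 3 * `|x| &
      forall x, series (t^~ x) @ \oo --> J x].
Proof.
have cvgt x : cvgn (series (t^~ x)).
  apply/cauchy_cvgP/cauchy_exP => e e0.
  have xp : 0 < 2 * (`|x| + 1) by rewrite mulr_gt0 ?ltr0n ?ltr_wpDl ?ltr01.
  have [N Ne] := half_expr_lt (divr_gt0 e0 xp).
  exists (series (t^~ x) N); exists N => // n /= Nn.
  rewrite -ball_normE /= distrC sub_series_geq //.
  apply: le_lt_trans (tail_le _ Nn) _.
  move: Ne; rewrite ltr_pdivlMr //; apply: le_lt_trans.
  rewrite [2 * _]mulrC -mulrA ler_wpM2l ?exprn_ge0 ?invr_ge0 ?ler0n //.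
  by rewrite ler_wpM2l ?ler0n // lerDl ler01.
exists (fun x => limn (series (t^~ x))).
have cvgJ x : series (t^~ x) @ \oo --> limn (series (t^~ x)) by exact: cvgt.
have linJ : linear (fun x => limn (series (t^~ x))).
  move=> c x y; apply: cvg_lim => //.
  have -> : series (t^~ (c *: x + y)) =
      (fun n => c *: series (t^~ x) n + series (t^~ y) n).
    apply/funext => n; rewrite /series /= scaler_sumr -big_split /=.
    by apply: eq_bigr => i _; rewrite linear_t.
  apply: cvgD; last exact: cvgJ.
  by apply: cvgZl_tmp; exact: cvgJ.
split=> // x.
have [->|x0] := eqVneq x 0.
  have -> : series (t^~ 0) = cst 0.
    apply/funext => n; rewrite /series /= big1 // => i _.
    by apply/eqP; rewrite -normr_le0 (le_trans (norm_t _ _)) // normr0 mulr0.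
  by rewrite lim_cst // !normr0 mulr0.
have nx : 0 < `|x| by rewrite normr_gt0.
have /cvgrPdist_lt/(_ _ nx)[N _ /(_ N (leqnn _)) JN] := cvgJ x.
rewrite -[X in `|X|](subrK (series (t^~ x) N)) (le_trans (ler_normD _ _)) //.
have -> : 3 * `|x| = `|x| + 2 * 2^-1 ^+ 0 * `|x| by rewrite expr0; ring.
by apply: lerD; [exact: ltW JN | exact: (tail_le x (leq0n N))].
Qed.

End GeometricSum.

(** * Inner products and orthonormal systems *)

Section InnerProduct.
Variables (R : realType) (k : scalars).
Local Notation K := (scalar_field R k).
Variables (X : completeNormedModType K) (ip : {dot X for @sconj R k}).
Hypothesis norm_ip : forall x : X, `|x| ^+ 2 = ip x x.

Lemma ipDl x y z : ip (x + y) z = ip x z + ip y z.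
Proof. exact: linearDl. Qed.

Lemma ipZl c x z : ip (c *: x) z = c * ip x z.
Proof. exact: linearZl_LR. Qed.

Lemma ipC x y : ip x y = sconj (ip y x).
Proof. by rewrite hermC expr0 mul1r. Qed.

Lemma ipDr x y z : ip z (x + y) = ip z x + ip z y.
Proof. by rewrite linearDr. Qed.

Lemma ipZr c x z : ip z (c *: x) = sconj c * ip z x.
Proof. by rewrite linearZr. Qed.

Lemma ip_suml I (r : seq I) (F : I -> X) z :
  ip (\sum_(i <- r) F i) z = \sum_(i <- r) ip (F i) z.
Proof.
elim: r => [|i r IH]; first by rewrite !big_nil linear0l.
by rewrite !big_cons ipDl IH.
Qed.

Lemma ip_sumr I (r : seq I) (F : I -> X) z :
  ip z (\sum_(i <- r) F i) = \sum_(i <- r) ip z (F i).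
Proof. by rewrite raddf_sum. Qed.

Lemma norm_unit x : ip x x = 1 -> `|x| = 1.
Proof.
by move=> x1; apply/eqP; rewrite -(@eqrXn2 _ 2) // norm_ip x1 expr1n.
Qed.

Fact riesz_subproof (v : X) : (fun x => ip x v) \in continuous_functional X.
Proof.
apply/continuous_functionalP; split=> [c x y|]; first by rewrite ipDl ipZl.
move=> x; apply: (@continuous_comp _ _ _ (fun x => (x, v))
  (fun p : X * X => ip p.1 p.2 : K^o)); last exact: (ip_continuous norm_ip).
by apply: (@cvg_pair _ _ _ _ (nbhs x) (nbhs v)); [exact: cvg_id|exact: cvg_cst].
Qed.

Definition riesz (v : X) : dual X := Dual (riesz_subproof v).

Definition orthoproj (s : seq X) (x : X) : X := \sum_(v <- s) ip x v *: v.

Lemma orthoproj_adj s x y : ip (orthoproj s x) y = ip x (orthoproj s y).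
Proof.
rewrite ip_suml ip_sumr; apply: eq_bigr => v _.
by rewrite ipZl ipZr mulrC -ipC.
Qed.

Lemma orthoproj_orth s u :
  (forall v, v \in s -> ip u v = 0) -> orthoproj s u = 0.
Proof.
by move=> us; rewrite /orthoproj big1_seq // => v /= vs; rewrite us ?scale0r.
Qed.

Lemma orthonormal_consP u s :
  reflect [/\ ip u u = 1, forall v, v \in s -> ip u v = 0 & orthonormal ip s]
          (orthonormal ip (u :: s)).
Proof.
rewrite /orthonormal /= andbT; apply: (iffP idP).
  case/andP=> /andP[/eqP uu ->] /andP[/allP us ->]; split=> // v vs.
  exact/eqP/us.
case=> -> us /andP[-> ->]; rewrite eqxx !andbT /=.
by apply/allP=> v vs /=; rewrite us.
Qed.

Lemma orthoproj_mem s w : orthonormal ip s -> w \in s -> orthoproj s w = w.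
Proof.
elim: s => [//|u s IH] /orthonormal_consP[uu us os].
rewrite /orthoproj big_cons -/(orthoproj s w) inE => /predU1P[->|ws].
  by rewrite uu scale1r orthoproj_orth ?addr0.
by rewrite ipC us // rmorph0 scale0r add0r IH.
Qed.

(** One Gram-Schmidt step: the new vector is the normalized residual of x. *)
Lemma orthonormal_extend s x : orthonormal ip s -> orthoproj s x != x ->
  exists2 u, orthonormal ip (u :: s) & orthoproj (u :: s) x = x.
Proof.
move=> os xs; set r := x - orthoproj s x.
have r0 : `|r| != 0 by rewrite normr_eq0 subr_eq0 eq_sym.
have rs v : v \in s -> ip r v = 0.
  by move=> vs; rewrite linearBl /= orthoproj_adj orthoproj_mem // subrr.
have rr : sconj (`|r|) = `|r|.
  by apply: (mulfI r0); rewrite mul_sconj normr_id.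
have xr : ip x r = `|r| ^+ 2.
  rewrite norm_ip -{1}(subrK (orthoproj s x) x) -/r ipDl orthoproj_adj.
  by rewrite orthoproj_orth // linear0r addr0.
exists (`|r|^-1 *: r).
  apply/orthonormal_consP; split=> // [|v vs]; last by rewrite ipZl rs ?mulr0.
  by rewrite ipZl ipZr fmorphV /= rr -norm_ip expr2 mulKf ?mulVf.
rewrite /orthoproj big_cons -/(orthoproj s x) ipZr fmorphV /= rr xr scalerA.
by rewrite expr2 mulKf ?divff // scale1r subrK.
Qed.

Lemma orthonormal_span (l : seq X) :
  exists2 s, orthonormal ip s & forall x, x \in l -> orthoproj s x = x.
Proof.
elim: l => [|y l [s os fs]]; first by exists [::].
have [ys|ys] := eqVneq (orthoproj s y) y.
  by exists s => // x; rewrite inE => /predU1P[->//|/fs].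
have [u ous uy] := orthonormal_extend os ys.
exists (u :: s) => // x; rewrite inE => /predU1P[->//|/fs xs].
have /orthonormal_consP[_ us _] := ous.
rewrite /orthoproj big_cons -/(orthoproj s x) -xs orthoproj_adj.
rewrite orthoproj_orth // linear0r.
by rewrite scale0r add0r !xs.
Qed.

(** Gram-Schmidt applied to a spanning family leaves every spanning vector fixed
    by the projection; by linearity the projection is then the identity. *)
Lemma orthonormal_basis : finite_dimensional X ->
  exists2 s, orthonormal ip s & forall x, orthoproj s x = x.
Proof.
move=> [n [e spe]]; have [s os fs] := orthonormal_span (codom e).
exists s => // x; have [c ->] := spe x.
rewrite /orthoproj; under eq_bigr => v _ do rewrite ip_suml scaler_suml.
rewrite exchange_big /=; apply: eq_bigr => i _.
rewrite -[in RHS](fs (e i)) ?codom_f // scaler_sumr.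
by apply: eq_bigr => v _; rewrite ipZl scalerA.
Qed.

(** If the span of every finite orthonormal system is proper, the Gram-Schmidt
    step can be iterated for ever. *)
Lemma orthonormal_sequence : ~ finite_dimensional X ->
  exists e : nat -> X, forall i j, ip (e i) (e j) = (i == j)%:R.
Proof.
move=> infX.
have step (s : seq X) : exists u, orthonormal ip s -> orthonormal ip (u :: s).
  case: (boolP (orthonormal ip s)) => [os|_]; last by exists 0.
  have [x xs] : exists x, orthoproj s x != x.
    apply: contra_notP infX => /forallNP fs.
    exists (size s), (fun i => s`_i) => x.
    exists (fun i => ip x s`_i); have /negP := fs x; rewrite negbK => /eqP xs.
    by rewrite -{1}xs /orthoproj (big_nth 0) big_mkord.
  by have [u ou _] := orthonormal_extend os xs; exists u.
have [next nextP] := choice step.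
pose t n := iter n (fun s => next s :: s) [::].
have ot n : orthonormal ip (t n) by elim: n => [//|n IH]; exact: nextP.
pose e n := next (t n).
have te i j : (i < j)%N -> e i \in t j.
  elim: j => [//|j IH]; rewrite ltnS leq_eqVlt inE => /predU1P[->|/IH ->].
    by rewrite eqxx.
  by rewrite orbT.
have oe j : [/\ ip (e j) (e j) = 1, forall v, v \in t j -> ip (e j) v = 0
    & orthonormal ip (t j)].
  exact/orthonormal_consP/(ot j.+1).
exists e => i j; have [ij|ji|->] := ltngtP i j.
- by have [_ /(_ _ (te _ _ ij)) ji _] := oe j; rewrite ipC ji rmorph0.
- by have [_ /(_ _ (te _ _ ji)) ->] := oe i.
- by have [-> _ _] := oe j.
Qed.

(** * Ternary derivations of a Hilbert triple *)

Lemma dualB (f g : dual X) x : (f - g) x = f x - g x.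
Proof. by []. Qed.

Lemma dual_sum I (r : seq I) (f : I -> dual X) x :
  (\sum_(i <- r) f i) x = \sum_(i <- r) f i x.
Proof. by elim: r => [|i r IH]; rewrite ?big_nil ?big_cons // dualDE IH. Qed.

Local Notation T := (hilbert_triple norm_ip).

Lemma dual_hilbert (phi : dual X) (a b c : X) :
  phi (hilbert_prod ip a b c) = 2^-1 * (ip a b * phi c + ip c b * phi a) :> K.
Proof. by rewrite /hilbert_prod linearZ linearD !linearZ. Qed.

Let sconj2 : sconj (2^-1 : K) = 2^-1.
Proof. by rewrite fmorphV rmorph_nat. Qed.

Lemma elementary_derivationE (b : X) (phi : dual X) (a x : X) :
  elementary_derivation T b phi a x =
  2^-1 * (ip x b * sconj (phi a) + ip x a * sconj (phi b)
          - ip b a * phi x - ip x a * phi b) :> K.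
Proof.
rewrite /elementary_derivation dualB /= !dual_hilbert !rmorphM /= sconj2.
rewrite rmorphD !rmorphM /= -!ipC -mulrBr opprD addrA.
by congr (_ * (_ - _ - _)); rewrite addrC.
Qed.

(** Skew-adjointness of the operator D with delta(a)(x) = (x | D a). *)
Definition skew_form (delta : X -> dual X) :=
  forall a b, delta a b = - sconj (delta b a : K) :> K.

Section ConjugateLinear.
Variable delta : X -> dual X.
Hypothesis ld : linear_for (sconj \; *:%R) delta.

Let delta_linear : {linear X -> dual X | sconj \; *:%R} :=
  HB.pack delta (GRing.isLinear.Build _ _ _ _ delta ld).

Let deltaD a b : delta (a + b) = delta a + delta b.
Proof. exact: (linearD delta_linear). Qed.

Let deltaZ c a : delta (c *: a) = sconj c *: delta a.
Proof. exact: (linearZ_LR delta_linear). Qed.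

Lemma conj_linear0 : delta 0 = 0.
Proof. exact: (linear0 delta_linear). Qed.

Lemma conj_linear_sum I (r : seq I) (c : I -> K) (F : I -> X) x :
  delta (\sum_(i <- r) c i *: F i) x
    = \sum_(i <- r) sconj (c i) * delta (F i) x :> K.
Proof.
rewrite [delta _](linear_sum delta_linear) dual_sum.
by apply: eq_bigr => i _; rewrite [delta_linear _]deltaZ.
Qed.

Lemma conj_linear_hilbert a b c x :
  delta (hilbert_prod ip a b c) x
    = 2^-1 * (ip b a * delta c x + ip b c * delta a x) :> K.
Proof.
by rewrite !(deltaZ, deltaD) dualZE dualDE !dualZE sconj2 -!ipC.
Qed.

End ConjugateLinear.

Lemma skew_derivation (delta : X -> dual X) :
  linear_for (sconj \; *:%R) delta -> skew_form delta ->
  ternary_derivation T delta.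
Proof.
move=> ld sd; split=> // a b c; apply: dual_ext => x.
rewrite !dualDE /= !dual_hilbert conj_linear_hilbert //.
rewrite !rmorphM /= sconj2 rmorphD !rmorphM /= -!ipC.
by rewrite (sd a b) (sd c b); ring.
Qed.

(** The derivation rule at the triple (a, b, a), evaluated at a, reduces to
    (a | a) (delta(a)(b) + conj (delta(b)(a))) = 0. *)
Lemma derivation_skew (delta : X -> dual X) :
  ternary_derivation T delta -> skew_form delta.
Proof.
move=> [ld dd] a b; apply/eqP; rewrite -addr_eq0.
have [->|a0] := eqVneq a 0.
  by rewrite conj_linear0 // linear0 rmorph0 addr0.
have := congr1 (fun f : dual X => f a : K) (dd a b a).
rewrite !dualDE /= !dual_hilbert !rmorphM /= sconj2 rmorphD !rmorphM /=.
rewrite conj_linear_hilbert // -!ipC => /eqP.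
rewrite -subr_eq0; set l := (X in X == 0).
have -> : l = - (ip a a * (delta a b + sconj (delta b a))).
  by rewrite /l; field.
by rewrite oppr_eq0 mulf_eq0 -norm_ip expf_eq0 normr_eq0 (negPf a0).
Qed.

(** With D the operator of delta, an orthonormal basis gives
    D a = sum_v (a | v) D v and also, by skewness, D a = - sum_v (a | D v) v,
    so the two halves of the elementary derivations of the pairs
    (v, - delta(v)) each contribute half of delta; what remains is the trace
    term. *)
Lemma finite_dimensional_inner (delta : X -> dual X) :
  finite_dimensional X -> ternary_derivation T delta ->
  inner_ternary_derivation T delta.
Proof.
move=> /orthonormal_basis[s os fs] dd; have [ld _] := dd.
have sd := derivation_skew dd.
pose t : K := \sum_(v <- s) delta v v.
have tc : sconj t = - t.
  rewrite rmorph_sum -sumrN; apply: eq_bigr => v _ /=.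
  by rewrite [in RHS]sd opprK.
(* Put delta'(a) = delta(a) - c (. | a).  The pairs (v, - delta'(v)) give
   a |-> delta'(a) + (t - c dim X) (. | a), which is delta for this c. *)
have [c cc cE] : exists2 c : K, sconj c = - c & c * (1 + (size s)%:R) = t.
  exists (t / (1 + (size s)%:R)); last by rewrite divfK // nat1r pnatr_eq0.
  by rewrite rmorphM /= fmorphV /= rmorphD rmorph1 rmorph_nat tc mulNr.
pose phi v : dual X := c *: riesz v - delta v.
have phiE v y : phi v y = c * ip y v - delta v y :> K by [].
have cphiE v y : sconj (phi v y : K) = - c * ip v y - sconj (delta v y : K).
  by rewrite phiE rmorphB rmorphM /= cc -ipC.
exists (size s), (fun i => s`_i), (fun i => phi s`_i) => a.
apply: dual_ext => x; rewrite dual_sum.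
have -> : \sum_(i < size s) elementary_derivation T s`_i (phi s`_i) a x
    = \sum_(v <- s) elementary_derivation T v (phi v) a x :> K.
  by rewrite (big_nth 0) big_mkord.
have termE v : v \in s -> elementary_derivation T v (phi v) a x =
  2^-1 * (ip x v * delta a v) + 2^-1 * (ip v a * delta v x)
  - c * (ip x v * ip v a) + ip x a * delta v v - ip x a * c :> K.
  move=> vs; have vv : ip v v = 1.
    by case/andP: os => /allP/(_ _ vs)/eqP.
  rewrite elementary_derivationE !cphiE !phiE vv.
  have -> : sconj (delta v a : K) = - delta a v by rewrite (sd a v) opprK.
  have -> : sconj (delta v v : K) = - delta v v.
    by rewrite [in RHS](sd v v) opprK.
  by rewrite mulr1; field.
have deltaE : delta a x = \sum_(v <- s) ip v a * delta v x :> K.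
  by rewrite -{1}(fs a) conj_linear_sum //; under eq_bigr do rewrite -ipC.
have ipE : ip x a = \sum_(v <- s) ip x v * ip v a.
  by rewrite -{1}(fs x) ip_suml; under eq_bigr do rewrite ipZl.
rewrite (eq_big_seq _ termE) !(sumrB, big_split) /= -!mulr_sumr -/t.
rewrite -ipE -deltaE big_const_seq count_predT iter_addr_0 -cE -mulr_natr.
have -> : \sum_(v <- s) ip x v * delta a v = delta a x :> K.
  rewrite -[in RHS](fs x) linear_sum; apply: eq_bigr => v _; exact/esym/linearZ.
by field.
Qed.

(** The skew part of J is written without the adjoint of J, which then need not
    be constructed. *)
Lemma skew_part_derivation (J : X -> X) (C : K) :
  linear J -> (forall x, `|J x| <= C * `|x|) ->
  exists delta : X -> dual X,
    [/\ ternary_derivation T delta, continuous delta &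
        forall a x, delta a x = ip x (J a) - ip (J x) a :> K].
Proof.
move=> lJ JC.
pose J' : {linear X -> X} := HB.pack J (GRing.isLinear.Build _ _ _ _ J lJ).
have JB x y : J (x - y) = J x - J y by exact: (linearB J').
have cJ : continuous J by exact: bounded_additive_continuous JB JC.
have dJ a : (fun x => ip (J x) a : K) \in continuous_functional X.
  apply/continuous_functionalP; split=> [c x y|x].
    by rewrite lJ ipDl ipZl.
  apply: (@continuous_comp _ _ _ J (riesz a)); first exact: cJ.
  exact: dual_continuous.
have [delta deltaE] : exists delta : X -> dual X,
    forall a x, delta a x = ip x (J a) - ip (J x) a :> K.
  by exists (fun a => riesz (J a) - Dual (dJ a)).
exists delta; split=> //.
- apply: skew_derivation => [c a b|a b].
    apply: dual_ext => x; rewrite dualDE dualZE !deltaE lJ !ipDr !ipZr.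
    by rewrite /=; ring.
  by rewrite !deltaE rmorphB /= -!ipC opprB.
- apply: (@bounded_additive_continuous _ _ _ _ (2 * C)) => [a b|a].
    apply: dual_ext => x; rewrite dualB !deltaE JB !linearBr /=.
    by ring.
  apply: dual_norm_le => x x1; rewrite deltaE.
  apply: le_trans (ler_normB _ _) _.
  have JCx : `|J x| <= C * `|x| := JC x.
  have -> : 2 * C * `|a| = C * `|a| + C * `|a| by ring.
  have [->|a0] := eqVneq a 0.
    have := JC 0; rewrite normr0 mulr0 normr_le0 => /eqP ->.
    by rewrite !linear0r normr0.
  have C0 : 0 <= C.
    have := le_trans (normr_ge0 _) (JC a).
    by rewrite pmulr_lge0 // normr_gt0.
  apply: lerD; apply: le_trans (ip_norm_le norm_ip _ _) _.
    rewrite -[leRHS]mul1r; apply: ler_pM => //; exact: JC.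
  rewrite ler_wpM2r // (le_trans (JC _)) // -[leRHS]mulr1.
  by rewrite ler_wpM2l.
Qed.

(** An elementary derivation of the pair (b, phi) acts as a scalar on every
    vector a with phi(a) = 0 and (a | b) = 0.  For n pairs these are 2n linear
    conditions, so they have a nonzero solution among the combinations of any
    2n + 1 vectors. *)
Lemma inner_scalar_vector (delta : X -> dual X) (f : nat -> X) :
  inner_ternary_derivation T delta ->
  exists (N : nat) (u : 'I_N -> K) (c : K), (exists m, u m != 0) /\
    forall x, delta (\sum_i u i *: f i) x = c * ip x (\sum_i u i *: f i) :> K.
Proof.
move=> [n [b [phi deltaE]]].
pose N := (n + n).+1.
pose A : 'M[K]_(N, n + n) := row_mx (\matrix_(j, i) (phi i (f j) : K))
  (\matrix_(j, i) ip (f j) (b i)).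
have /rowV0Pn[u /sub_kermxP] : kermx A != 0.
  by rewrite -mxrank_eq0 mxrank_ker subn_eq0 -ltnNge ltnS rank_leq_col.
rewrite mul_mx_row => /eqP; rewrite row_mx_eq0 => /andP[/eqP uphi /eqP ub] u0.
pose a := \sum_i u 0 i *: f i.
have phia i : phi i a = 0 :> K.
  have := congr1 (fun M : 'rV[K]_n => M 0 i) uphi; rewrite !mxE => <-.
  rewrite linear_sum; apply: eq_bigr => j _; rewrite mxE; exact: linearZ.
have ab i : ip a (b i) = 0.
  have := congr1 (fun M : 'rV[K]_n => M 0 i) ub; rewrite !mxE => <-.
  by rewrite ip_suml; apply: eq_bigr => j _; rewrite ipZl mxE.
exists N, (u 0), (\sum_i 2^-1 * (sconj (phi i (b i) : K) - phi i (b i))); split.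
  by have /rV0Pn := u0.
move=> x; rewrite deltaE dual_sum mulr_suml; apply: eq_bigr => i _.
rewrite elementary_derivationE -/a phia (ipC (b i)) ab rmorph0.
by ring.
Qed.

(** The weights 2^-n make J a geometric series, so that no Bessel inequality is
    involved.  The contradiction comes from pairing delta(a) with the vector
    g_m, where a has a nonzero coefficient at f_m. *)
Lemma amenable_finite_dimensional :
  ternary_weakly_amenable T -> finite_dimensional X.
Proof.
move=> wa; apply: contrapT => /orthonormal_sequence[e oe].
pose f n := e n.*2; pose g n := e n.*2.+1.
have ff i j : ip (f i) (f j) = (i == j)%:R by rewrite oe (inj_eq double_inj).
have gg i j : ip (g i) (g j) = (i == j)%:R.
  by rewrite oe eqSS (inj_eq double_inj).
have ff1 i : ip (f i) (f i) = 1 by rewrite ff eqxx.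
have gg1 i : ip (g i) (g i) = 1 by rewrite gg eqxx.
have gf i j : ip (g i) (f j) = 0.
  rewrite oe; case: eqP => // /(congr1 odd).
  by rewrite /= !odd_double.
pose t n x := 2^-1 ^+ n *: (ip x (f n) *: g n).
have lt n : linear (t n).
  move=> c x y; rewrite /t ipDl ipZl scalerDl !scalerDr !scalerA.
  by congr (_ *: _ + _); ring.
have nt n x : `|t n x| <= 2^-1 ^+ n * `|x|.
  rewrite !normrZ normrX ger0_norm ?invr_ge0 ?ler0n //.
  rewrite ler_wpM2l ?exprn_ge0 ?invr_ge0 ?ler0n //.
  rewrite (norm_unit (gg1 n)) mulr1.
  apply: le_trans (ip_norm_le norm_ip _ _) _.
  by rewrite (norm_unit (ff1 n)) mulr1.
have [J [lJ JC cJ]] := geometric_sum_operator lt nt.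
have Jf m : J (f m) = 2^-1 ^+ m *: g m.
  apply: (cvg_unique _ (cJ (f m))) => //.
  apply: cvg_near_cst; exists m.+1 => // n /= mn.
  rewrite /series /= (bigD1_seq m) ?mem_index_iota ?iota_uniq //=.
  rewrite /t ff eqxx scale1r big1 ?addr0 // => i im.
  by rewrite ff eq_sym (negPf im) scale0r scaler0.
have Jg m : J (g m) = 0.
  apply: (cvg_unique _ (cJ (g m))) => //.
  apply: cvg_near_cst; exists 0%N => // n _.
  by rewrite /series /= big1 // => i _; rewrite /t gf scale0r scaler0.
have [delta [dd cd deltaE]] := skew_part_derivation lJ JC.
have [N [u [c [[m um]]]]] := inner_scalar_vector f (wa delta dd cd).
move=> /(_ (g m)); rewrite deltaE Jg linear0l subr0.
pose J' : {linear X -> X} := HB.pack J (GRing.isLinear.Build _ _ _ _ J lJ).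
have -> : J (\sum_i u i *: f i) = \sum_i u i *: J (f i).
  rewrite [LHS](linear_sum J'); apply: eq_bigr => i _.
  exact: (linearZ_LR J').
rewrite !ip_sumr [in RHS]big1 ?mulr0; last first.
  by move=> i _; rewrite ipZr gf mulr0.
rewrite (bigD1 m) //= [X in _ + X]big1 => [|i im]; last first.
  by rewrite Jf !ipZr gg eq_sym (inj_eq val_inj) (negPf im) !mulr0.
rewrite Jf !ipZr gg eqxx mulr1 addr0 => /eqP.
rewrite mulf_eq0 !fmorph_eq0 (negPf um) /= expf_eq0 invr_eq0 pnatr_eq0 andbF.
by [].
Qed.

End InnerProduct.

Theorem proposition5p4 (R : realType) (k : scalars)
    (X : completeNormedModType (scalar_field R k))
    (ip : {dot X for @sconj R k})
    (norm_ip : forall x : X, `|x| ^+ 2 = ip x x) :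
  ternary_weakly_amenable (hilbert_triple norm_ip) <-> finite_dimensional X.
Proof.
split; first exact: amenable_finite_dimensional.
by move=> finX delta dd _; exact: finite_dimensional_inner.
Qed.
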